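(* Let $A\in\mathbb{C}^{n\times n}$ and, for $Q\in U(n)$, consider the normal matrix $N(Q):=Q\,\mathrm{diag}(Q^*AQ)\,Q^*$ and $f_A(Q)=\|\mathcal{N}(Q^*AQ)\|_F^2$. 1. $[Q_0]$ is a global minimizer of $f_A$ on $\mathcal{F}_n$ if and only if $N(Q_0)$ is a global minimizer of $\|A-X\|_F^2$ over the normal matrices $X\in\mathbb{C}^{n\times n}$. 2. Let $N_0\in\mathbb{C}^{n\times n}$ be normal and let $\mathcal{R}:=\{Q\in U(n): Q^*N_0Q\text{ is diagonal}\}$. Then $N_0$ is a local minimizer of $\|A-X\|_F^2$ over the normal matrices if and only if, for every $Q\in\mathcal{R}$, one has $N(Q)=N_0$ and $[Q]$ is a local minimizer of $f_A$ on $\mathcal{F}_n$. Moreover, the same correspondences hold for the minimizers of $f_A$ on $U(n)$: statements 1 and 2 remain true with $[Q_0]$, $[Q]$, $\mathcal{F}_n$ replaced by $Q_0$, $Q$, $U(n)$ respectively.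
   Context: A matrix $X\in\mathbb{C}^{n\times n}$ is normal if $XX^*=X^*X$. $\|X\|_F^2=\mathrm{trace}(X^*X)$ is the squared Frobenius norm. $\mathrm{diag}(X)$ denotes the diagonal matrix whose diagonal entries coincide with those of $X$, and $\mathcal{N}(X):=X-\mathrm{diag}(X)$. $U(n)$ is the group of $n\times n$ unitary matrices and $\mathcal{F}_n:=U(n)/U(1)^n$ (the flag manifold) is its quotient by right multiplication by diagonal unitary matrices; $[Q]$ is the class of $Q$. Both $f_A(Q)$ and $N(Q)$ depend only on $[Q]$, so they are also regarded as functions on $\mathcal{F}_n$. The set of normal matrices carries the topology induced from $\mathbb{C}^{n\times n}$. *)

(* Defs.v *)
From HB Require Import structures.
From mathcomp Require Import all_boot all_order all_algebra.
From mathcomp Require Import all_classical all_reals all_analysis.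
From mathcomp Require Import complex.
From mathcomp Require Import spectral.

Set Implicit Arguments.
Unset Strict Implicit.
Unset Printing Implicit Defensive.

Import Order.TTheory GRing.Theory Num.Theory Num.Def.
Import numFieldNormedType.Exports.

Local Open Scope classical_set_scope.
Local Open Scope ring_scope.
Local Open Scope sesquilinear_scope.
Local Open Scope complex_scope.
Local Open Scope quotient_scope.

(* The generic norm topology of a numClosedFieldType is not found by
   unification on the concrete type R[i]; this instance is convertible to it.
   Matrices over R[i] then inherit the (entrywise) topology of C^(m x n). *)
HB.instance Definition _ (R : realType) := NormedModule.copy R[i] R[i]^o.

Definition global_minimizer_on (R : realType) (T : Type) (S : set T)
    (f : T -> R) (x : T) : Prop :=
  S x /\ forall y, S y -> f x <= f y.

(* [within S (nbhs x)] is the neighbourhood filter of x for the topology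
   induced on S. *)
Definition local_minimizer_on (R : realType) (T : topologicalType) (S : set T)
    (f : T -> R) (x : T) : Prop :=
  S x /\ \forall y \near within S (nbhs x), f x <= f y.

Section Matrices.
Variables (R : realType) (n : nat).
Local Notation C := R[i].
Implicit Types (A X : 'M[C]_n).

(* The trace is a real number: see [frobenius_sqE]. *)
Definition frobenius_sq X : R := complex.Re (\tr (X ^t* *m X)).

Lemma frobenius_sqE X : (frobenius_sq X)%:C = \tr (X ^t* *m X).
Proof.
have : \tr (X ^t* *m X) \is Num.real.
  apply: ger0_real; rewrite /mxtrace; apply: sumr_ge0 => i _.
  rewrite mxE; apply: sumr_ge0 => j _.
  by rewrite !mxE mulrC mul_conjC_ge0.
by move=> /RRe_real.
Qed.

Definition diag_part X : 'M[C]_n := diag_mx (\row_i X i i).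

Definition offdiag_part X : 'M[C]_n := X - diag_part X.

Definition normal_set : set 'M[C]_n := [set X | X \is normalmx].

Definition unitary_group : set 'M[C]_n := [set Q | Q \is unitarymx].

Lemma unitary_groupP (Q : unitary_group) : \val Q \is unitarymx.
Proof. by have := valP Q; rewrite inE. Qed.

(* Q1 and Q2 are in the same coset of U(1)^n, the diagonal unitary matrices
   acting by right multiplication. *)
Definition flag_rel (Q1 Q2 : unitary_group) : bool :=
  `[< exists D : 'M[C]_n,
        [/\ D \is unitarymx, is_diag_mx D & \val Q2 = \val Q1 *m D] >].

Lemma is_diag_mx_adj (D : 'M[C]_n) : is_diag_mx D -> is_diag_mx (D ^t*).
Proof.
move=> /is_diag_mxP dD; apply/is_diag_mxP => i j ij.
by rewrite !mxE dD ?rmorph0// eq_sym.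
Qed.

Lemma flag_rel_equiv : equiv_class_of flag_rel.
Proof.
apply: EquivClass.
- move=> Q; apply/asboolP; exists 1%:M; split; last by rewrite mulmx1.
    by apply/unitarymxP; rewrite trmx1 map_mx1 mulmx1.
  by apply/is_diag_mxP => i j ij; rewrite mxE -val_eqE (negbTE ij).
- have sym Q1 Q2 : flag_rel Q1 Q2 -> flag_rel Q2 Q1.
    move=> /asboolP[D [uD dD E]]; apply/asboolP; exists (D ^t*); split.
    + by rewrite trmxC_unitary.
    + exact: is_diag_mx_adj.
    + by rewrite E -mulmxA (elimT unitarymxP uD) mulmx1.
  by move=> Q1 Q2; apply/idP/idP; apply: sym.
- move=> Q2 Q1 Q3 /asboolP[D [uD dD E]] /asboolP[D' [uD' dD' E']].
  apply/asboolP; exists (D *m D'); split.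
  + exact: mul_unitarymx.
  + apply/is_diag_mxP => i j ij; rewrite mxE big1// => k _.
    have [ik|ik] := eqVneq i k.
      by rewrite (elimT is_diag_mxP dD') ?mulr0// -ik.
    by rewrite (elimT is_diag_mxP dD) ?mul0r.
  + by rewrite E' E mulmxA.
Qed.

Canonical flag_equiv := EquivRelPack flag_rel_equiv.

Definition flag_manifold : Type := quotient_topology {eq_quot flag_equiv}.
HB.instance Definition _ := Topological.on flag_manifold.
HB.instance Definition _ := Quotient.on flag_manifold.

Definition flag_class (Q : unitary_group) : flag_manifold :=
  (\pi_flag_manifold Q)%qT.

Lemma flag_classP (Q1 Q2 : unitary_group) :
  flag_class Q1 = flag_class Q2 <-> flag_rel Q1 Q2.
Proof.
split; first by move=> /eqquotP.
by move=> h; apply/eqquotP.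
Qed.

Definition normal_of A (Q : unitary_group) : 'M[C]_n :=
  \val Q *m diag_part ((\val Q) ^t* *m A *m \val Q) *m (\val Q) ^t*.

Definition diagonalizers X : set unitary_group :=
  [set Q | is_diag_mx ((\val Q) ^t* *m X *m \val Q)].

Definition offdiag_cost A (Q : unitary_group) : R :=
  frobenius_sq (offdiag_part ((\val Q) ^t* *m A *m \val Q)).

(* The function induced by [offdiag_cost A] on the quotient; it does not depend
   on the representative: see [flag_costE]. *)
Definition flag_cost A (x : flag_manifold) : R := offdiag_cost A (repr x).

Lemma diag_part_conj (D : 'M[C]_n) X : is_diag_mx D ->
  diag_part (D ^t* *m X *m D) = D ^t* *m diag_part X *m D.
Proof.
move=> /diag_mxP[d ->]; rewrite tr_diag_mx map_diag_mx.
apply/matrixP => i j; rewrite !mul_mx_diag !mul_diag_mx !mxE.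
by have [->|ij] := eqVneq i j; rewrite ?mulr1n ?mulr0n ?mulr0 ?mul0r.
Qed.

Lemma frobenius_sq_conj (D : 'M[C]_n) X : D \is unitarymx ->
  frobenius_sq (D ^t* *m X *m D) = frobenius_sq X.
Proof.
move=> uD; rewrite /frobenius_sq !trmx_mul !map_mxM /= trmxCK.
rewrite -!mulmxA mxtrace_mulC -!mulmxA (elimT unitarymxP uD) mulmx1.
by rewrite (mulmxA D) (elimT unitarymxP uD) mul1mx.
Qed.

Lemma flag_costE A (Q : unitary_group) :
  flag_cost A (flag_class Q) = offdiag_cost A Q.
Proof.
have : flag_rel Q (repr (flag_class Q)).
  by apply/flag_classP; rewrite /flag_class reprK.
move=> /asboolP[D [uD dD E]]; rewrite /flag_cost /offdiag_cost E.
rewrite trmx_mul map_mxM.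
have -> : D ^t* *m (\val Q) ^t* *m A *m (\val Q *m D)
        = D ^t* *m ((\val Q) ^t* *m A *m \val Q) *m D by rewrite !mulmxA.
rewrite /offdiag_part diag_part_conj//.
by rewrite -mulmxBl -mulmxBr frobenius_sq_conj.
Qed.

End Matrices.

Arguments global_minimizer_on {R T}.
Arguments normal_set {R n}.
Arguments local_minimizer_on {R T}.
Arguments unitary_group : clear implicits.
Arguments flag_manifold : clear implicits.

(* Main.v *)
Require Import Defs.
From HB Require Import structures.
From mathcomp Require Import all_boot all_order all_algebra.
From mathcomp Require Import all_classical all_reals all_analysis.
From mathcomp Require Import complex spectral.
Import Order.TTheory GRing.Theory Num.Theory Num.Def.
Import numFieldNormedType.Exports.
Local Open Scope classical_set_scope.
Local Open Scope ring_scope.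

(** Everything rests on one identity.  If the unitary [Q] diagonalizes [X], then
    conjugating by [Q] preserves the Frobenius norm and turns [A - X] into
    [Q^* A Q] minus a diagonal matrix; the off-diagonal and the diagonal entries
    contribute separately, so that
      |A - X|^2 = f_A(Q) + |N(Q) - X|^2   ([frobenius_sq_dist]).
    Hence N(Q) is the best approximation of [A] among the matrices that [Q]
    diagonalizes, at squared distance f_A(Q).  A matrix is normal exactly when
    some unitary matrix diagonalizes it, so minimizing the distance to [A] over
    normal matrices is minimizing f_A over unitary matrices.  This is the
    statement about global minimizers ([global_minimizer_unitary]).

    Let N0 be a local minimizer of the distance and let [Q] diagonalize it.  The
    segment from N0 to N(Q) consists of matrices diagonalized by [Q], hence
    normal, and by the identity the distance to [A] decreases strictly along it
    unless N(Q) = N0 ([local_minimizer_normal_of]).  As [N] is continuous and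
    f_A(Q') is the squared distance from [A] to N(Q'), the local minimality of
    N0 = N(Q) pulls back to [Q] ([local_minimizer_offdiag_cost]).

    The converse ([local_minimizer_of_diagonalizers]) needs every normal [X]
    close to N0 to have a diagonalizer at which f_A is at least
    f_A(Q) = |A - N0|^2.  Diagonalizers do not depend continuously on [X], so
    compactness of U(n) replaces continuity.  Every unitary [Q] has this
    property: all pairs (Q', X) near (Q, N0) such that [Q'] diagonalizes [X]
    satisfy f_A(Q') >= |A - N0|^2.  If [Q] diagonalizes N0 this is the local
    minimality of [Q]; otherwise no [Q'] near [Q] diagonalizes an [X] near N0.
    By compactness a single neighbourhood of N0 serves for all [Q'] at once.

    Passing to the flag manifold changes nothing because f_A is constant on the
    classes and the quotient map is continuous and open
    ([global_minimizer_flag], [local_minimizer_flag]). *)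

Set Implicit Arguments.
Unset Strict Implicit.
Unset Printing Implicit Defensive.

Local Open Scope sesquilinear_scope.
Local Open Scope complex_scope.

(** * Distance to the matrices diagonalized by a given unitary matrix *)

Lemma unitary_diag_normal (C : numClosedFieldType) n (V : 'M[C]_n) d :
  V \is unitarymx -> V *m diag_mx d *m V^t* \is normalmx.
Proof.
move=> uV; have VV : V^t* *m V = 1%:M := mulmx1C (elimT unitarymxP uV).
apply/normalmxP; rewrite !trmx_mul !map_mxM /= trmxCK tr_diag_mx map_diag_mx.
set e := map_mx _ _.
have VK (P S : 'M[C]_n) :
    (V *m P *m V^t*) *m (V *m S *m V^t*) = V *m (P *m S) *m V^t*.
  by rewrite -!mulmxA (mulmxA (V^t*)) VV mul1mx.
by rewrite (mulmxA V) !VK diag_mxC.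
Qed.

Section Pythagoras.
Variables (R : realType) (n : nat).
Local Notation C := R[i].
Implicit Types (A X M D : 'M[C]_n) (Q : unitary_group R n).

(** The squared modulus as a real number; the norm of a complex number is itself
    a complex number. *)
Definition sqnorm (z : C) : R := complex.Re (z^* * z)%R.

Lemma sqnorm_ge0 z : 0 <= sqnorm z.
Proof.
have /RRe_real H := ger0_real (mul_conjC_ge0 z).
by rewrite -ler0c /sqnorm mulrC H mul_conjC_ge0.
Qed.

Lemma sqnorm_eq0 z : sqnorm z = 0 -> z = 0.
Proof.
have /RRe_real H := ger0_real (mul_conjC_ge0 z).
move=> z0; apply/eqP; rewrite -mul_conjC_eq0 -H mulrC.
by rewrite -/(sqnorm z) z0.
Qed.

Lemma frobenius_sqE_sum X : frobenius_sq X = \sum_i \sum_j sqnorm (X j i).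
Proof.
rewrite /frobenius_sq /mxtrace raddf_sum; apply: eq_bigr => i _.
by rewrite mxE raddf_sum; apply: eq_bigr => j _; rewrite !mxE.
Qed.

Lemma frobenius_sq_ge0 X : 0 <= frobenius_sq X.
Proof.
by rewrite frobenius_sqE_sum; do 2 apply: sumr_ge0 => ? _; exact: sqnorm_ge0.
Qed.

Lemma frobenius_sq_eq0 X : frobenius_sq X = 0 -> X = 0.
Proof.
rewrite frobenius_sqE_sum => X0; apply/matrixP => j i; rewrite mxE.
apply: sqnorm_eq0; move: X0 => /eqP; rewrite psumr_eq0; last first.
  by move=> k _; apply: sumr_ge0 => l _; exact: sqnorm_ge0.
move=> /allP/(_ i (mem_index_enum _)) /=; rewrite psumr_eq0; last first.
  by move=> k _; exact: sqnorm_ge0.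
by move=> /allP/(_ j (mem_index_enum _)) /eqP.
Qed.

Lemma frobenius_sqZ (t : R) X :
  frobenius_sq (t%:C *: X) = t ^+ 2 * frobenius_sq X.
Proof.
rewrite !frobenius_sqE_sum mulr_sumr; apply: eq_bigr => i _.
rewrite mulr_sumr; apply: eq_bigr => j _.
have tC : ((t%:C)^* = t%:C)%R := conjc_real t.
rewrite mxE /sqnorm rmorphM/= tC mulrACA -rmorphM /= expr2.
by case: (_ * X j i) => a b; rewrite /= mul0r subr0.
Qed.

(** Pythagoras: the two summands involve disjoint sets of entries. *)
Lemma frobenius_sq_sub_diag M D : is_diag_mx D ->
  frobenius_sq (M - D)
  = frobenius_sq (offdiag_part M) + frobenius_sq (diag_part M - D).
Proof.
move=> /is_diag_mxP dD; rewrite !frobenius_sqE_sum -big_split/=.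
apply: eq_bigr => i _; rewrite -big_split/=; apply: eq_bigr => j _.
have sq0 : sqnorm 0 = 0 by rewrite /sqnorm mulr0.
rewrite !mxE; have [->|ij] := eqVneq j i.
  by rewrite mulr1n subrr sq0 add0r.
by rewrite mulr0n dD// !subr0 sq0 addr0.
Qed.

Lemma unitary_conjVK Q X :
  \val Q *m ((\val Q)^t* *m X *m \val Q) *m (\val Q)^t* = X.
Proof.
have uQ := elimT unitarymxP (unitary_groupP Q).
by rewrite !mulmxA uQ mul1mx -mulmxA uQ mulmx1.
Qed.

Lemma unitary_adjmx Q : (\val Q)^t* *m \val Q = 1%:M.
Proof. exact: mulmx1C (elimT unitarymxP (unitary_groupP Q)). Qed.

Lemma unitary_conjK Q X :
  (\val Q)^t* *m (\val Q *m X *m (\val Q)^t*) *m \val Q = X.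
Proof.
by rewrite !mulmxA unitary_adjmx mul1mx -mulmxA unitary_adjmx mulmx1.
Qed.

Lemma diag_part_is_diag X : is_diag_mx (diag_part X).
Proof. exact: diag_mx_is_diag. Qed.

Lemma conj_normal_of A Q :
  (\val Q)^t* *m normal_of A Q *m \val Q
  = diag_part ((\val Q)^t* *m A *m \val Q).
Proof. exact: unitary_conjK. Qed.

Lemma diagonalizers_normal_of A Q : diagonalizers (normal_of A Q) Q.
Proof. by rewrite /diagonalizers/= conj_normal_of diag_part_is_diag. Qed.

Lemma diagonalizers_normal X Q : diagonalizers X Q -> X \is normalmx.
Proof.
move=> /= /diag_mxP[d Ed]; rewrite -(unitary_conjVK Q X) Ed.
exact: unitary_diag_normal (unitary_groupP Q).
Qed.

(** The spectral theorem; the unitary matrix that it provides acts on the other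
    side, whence the adjoint. *)
Lemma normalmx_diagonalizer X : X \is normalmx -> exists Q, diagonalizers X Q.
Proof.
move=> /orthomx_spectralP; set P := spectralmx X => EX.
have uP : P \is unitarymx := spectral_unitarymx X.
have uP' : P^t* \is unitarymx by rewrite trmxC_unitary.
exists (SigSub (mem_set (uP' : unitary_group R n (P^t*)))).
rewrite /diagonalizers /= trmxCK EX invmx_unitary//.
rewrite !mulmxA (elimT unitarymxP uP) mul1mx -mulmxA (elimT unitarymxP uP).
by rewrite mulmx1 diag_mx_is_diag.
Qed.

(** Conjugation by [Q] is an isometry, after which [frobenius_sq_sub_diag]
    applies; undoing the conjugation in the diagonal term gives [normal_of]. *)
Lemma frobenius_sq_dist A X Q : diagonalizers X Q ->
  frobenius_sq (A - X) = offdiag_cost A Q + frobenius_sq (normal_of A Q - X).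
Proof.
move=> dX; rewrite -(frobenius_sq_conj _ (unitary_groupP Q)).
rewrite mulmxBr mulmxBl (frobenius_sq_sub_diag _ dX); congr (_ + _).
rewrite -[RHS](frobenius_sq_conj _ (unitary_groupP Q)).
by rewrite mulmxBr mulmxBl conj_normal_of.
Qed.

Lemma offdiag_costE A Q : offdiag_cost A Q = frobenius_sq (A - normal_of A Q).
Proof.
rewrite (frobenius_sq_dist A (@diagonalizers_normal_of A Q)) subrr.
by rewrite -(scaler0 _ (0%:C : C)) frobenius_sqZ expr0n mul0r addr0.
Qed.

Lemma offdiag_cost_le A X Q : diagonalizers X Q ->
  offdiag_cost A Q <= frobenius_sq (A - X).
Proof. by move=> /(frobenius_sq_dist A) ->; rewrite lerDl frobenius_sq_ge0. Qed.

Lemma normal_of_normal A Q : normal_set (normal_of A Q).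
Proof. exact: diagonalizers_normal (@diagonalizers_normal_of A Q). Qed.

Lemma global_minimizer_unitary A Q0 :
  global_minimizer_on [set: unitary_group R n] (offdiag_cost A) Q0
  <-> global_minimizer_on normal_set (fun X => frobenius_sq (A - X))
        (normal_of A Q0).
Proof.
split=> [[_ minQ]|[_ minN]]; split; [exact: normal_of_normal| |exact: I|].
- move=> X /normalmx_diagonalizer[Q dQ]; rewrite -offdiag_costE.
  exact: le_trans (minQ Q I) (offdiag_cost_le A dQ).
- by move=> Q _; rewrite !offdiag_costE; apply: minN; exact: normal_of_normal.
Qed.

(** Every class has a representative, and [flag_cost] is [offdiag_cost] at any
    of them. *)
Lemma global_minimizer_flag A Q0 :
  global_minimizer_on [set: flag_manifold R n] (flag_cost A) (flag_class Q0)
  <-> global_minimizer_on [set: unitary_group R n] (offdiag_cost A) Q0.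
Proof.
split=> -[_ minQ]; split; [exact: I| |exact: I|].
- by move=> Q _; have := minQ (flag_class Q) I; rewrite !flag_costE.
- by move=> x _; rewrite flag_costE; exact: (minQ (repr x) I).
Qed.

End Pythagoras.

(** * Continuity of matrix operations *)

Section ContinuityTools.

(** A neighbourhood of a matrix constrains each of the finitely many entries
    separately. *)
Lemma continuous_matrix (T U : topologicalType) m n (f : T -> 'M[U]_(m, n)) :
  (forall i j, continuous (fun x => f x i j)) -> continuous f.
Proof.
move=> cf x B [P /= Pf PB].
have : \forall y \near x, forall i j, P i j (f y i j).
  by apply: filter_forall => i; apply: filter_forall => j; exact: cf (Pf i j).
by apply: filterS => y Py; exact: PB.
Qed.

Variables (R : realType) (T : topologicalType).
Local Notation C := R[i].

Lemma continuous_coord n m (f : T -> 'M[C]_(n, m)) i j :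
  continuous f -> continuous (fun x => f x i j).
Proof.
move=> cf x; exact: (continuous_comp (cf x) (@coord_continuous C _ _ i j _)).
Qed.

Lemma continuous_cst_mx m n (M : 'M[C]_(m, n)) : continuous (fun _ : T => M).
Proof. by move=> x; exact: cvg_cst. Qed.

Lemma continuous_mulmx m n p (f : T -> 'M[C]_(m, n)) (g : T -> 'M[C]_(n, p)) :
  continuous f -> continuous g -> continuous (fun x => f x *m g x).
Proof.
move=> cf cg; apply: continuous_matrix => i j.
under eq_fun do rewrite mxE.
move=> x; apply: (@cvg_big C _ +%R 0 predT) => [|k _].
  exact: (@add_continuous C).
apply: cvgM; exact: continuous_coord.
Qed.

Lemma continuous_conjC : continuous (fun z : C => (z^*)%R).
Proof.
move=> z A /= /(nbhs_ballP (z^*)%R)[e e0 sA].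
apply/nbhs_ballP; exists e => //= y zy.
by apply: sA; rewrite /ball/= -rmorphB norm_conjC.
Qed.

Lemma continuous_trmxC m n (f : T -> 'M[C]_(m, n)) :
  continuous f -> continuous (fun x => f x ^t*).
Proof.
move=> cf; apply: continuous_matrix => i j.
under eq_fun do rewrite !mxE.
move=> x; apply: (continuous_comp _ (@continuous_conjC _)).
exact: continuous_coord.
Qed.

Lemma continuous_real_complex : continuous (fun t : R => t%:C : C).
Proof.
move=> t A /= /(nbhs_ballP (t%:C : C))[e /= e0 sA].
(* The radius of a ball of [C] is a positive element of [C], hence real. *)
have eE : e = (complex.Re e)%:C by rewrite RRe_real// gtr0_real.
apply/nbhs_ballP; exists (complex.Re e); first by rewrite /= -ltcR -eE.
move=> s /= ts; apply: sA.
rewrite /ball/= -rmorphB/= normc_def/= expr0n addr0 sqrtr_sqr eE ltcR.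
exact: ts.
Qed.

End ContinuityTools.

(** * Compactness of the unitary group *)

Section CompactUnitary.

(** Through [vec_mx] this reduces to Tychonoff's theorem for row vectors. *)
Lemma compact_matrix (F : numFieldType) m n (B : set F) :
  compact B -> compact [set M : 'M[F]_(m, n) | forall i j, B (M i j)].
Proof.
move=> cB.
have cvec : continuous (vec_mx : 'rV[F]_(m * n) -> 'M[F]_(m, n)).
  apply: continuous_matrix => i j; under eq_fun do rewrite mxE.
  exact: coord_continuous.
have := continuous_compact (continuous_subspaceT cvec) (rV_compact (fun=> cB)).
congr compact; apply/seteqP; split=> M /=.
  by move=> [u uB <-] i j; rewrite mxE.
move=> MB; exists (mxvec M); last exact: mxvecK.
by move=> k; case/mxvec_indexP: k => i j; rewrite mxvecE.
Qed.

Variables (R : realType).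
Local Notation C := R[i].

Lemma compact_square :
  compact [set z : C |
    complex.Re z \in `[-1, 1] /\ complex.Im z \in `[-1, 1]].
Proof.
pose f (p : R * R) : C := p.1%:C + 'i%C * p.2%:C.
have cf : continuous f.
  move=> p; apply: (@cvgD C C).
    exact: (continuous_comp (@cvg_fst _ _ _ _ _) (@continuous_real_complex R _)).
  apply: (@cvgM C); first exact: cvg_cst.
  exact: (continuous_comp (@cvg_snd _ _ _ _ _) (@continuous_real_complex R _)).
have cI := @segment_compact R (-1) 1.
have := continuous_compact (continuous_subspaceT cf) (compact_setX cI cI).
congr compact; apply/seteqP; split=> z /=.
  move=> [[a b] /= [Ia Ib] <-].
  by rewrite /f/= !(mul0r, mul1r, mulr0, subr0, add0r, addr0).
case: z => a b /= [Ia Ib]; exists (a, b) => //.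
rewrite /f; apply/eqP; rewrite eq_complex/=.
by rewrite !(mul0r, mul1r, mulr0, subr0, add0r, addr0) !eqxx.
Qed.

(** Each row of a unitary matrix is a unit vector. *)
Lemma unitarymx_entry_le1 n (M : 'M[C]_n) i j : M \is unitarymx -> `|M i j| <= 1.
Proof.
move=> /unitarymxP/matrixP/(_ i i); rewrite !mxE eqxx/= => E.
rewrite -(@expr_le1 _ 2)// -[leRHS]E (bigD1 j)//= !mxE -normCK lerDl.
by apply: sumr_ge0 => k _; rewrite !mxE -normCK exprn_ge0.
Qed.

(** Unitary matrices form a closed set, the preimage of [1%:M] under
    [M |-> M *m M^t*], inside the compact set of matrices with all entries in
    the square. *)
Lemma compact_unitarymx n : compact [set M : 'M[C]_n | M \is unitarymx].
Proof.
apply: (subclosed_compact _ (compact_matrix compact_square)); last first.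
  move=> M /= uM i j; have M1 := unitarymx_entry_le1 i j uM.
  rewrite !in_itv/= -!ler_norml -!lecR.
  split; first exact: le_trans (normc_ge_Re _) M1.
  apply: le_trans M1.
  by rewrite normc_def lecR -sqrtr_sqr ler_wsqrtr// lerDr sqr_ge0.
have -> : [set M : 'M[C]_n | M \is unitarymx]
    = (fun M => M *m M^t*) @^-1` [set 1%:M].
  by apply/seteqP; split=> M /=; [move/unitarymxP|move=> h; apply/unitarymxP].
have cid : continuous (id : 'M[C]_n -> 'M[C]_n) by move=> M; exact: cvg_id.
apply: preimage_closed.
  by move=> M _; exact: continuous_mulmx cid (continuous_trmxC cid) M.
apply: accessible_closed_set1; apply: hausdorff_accessible.
exact: norm_hausdorff.
Qed.

(** Compactness passes to the subtype, whose topology is the initial one for the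
    inclusion: a cluster point of the image of a filter is unitary, and is a
    cluster point of the filter itself. *)
Lemma compact_unitary_group n : compact [set: unitary_group R n].
Proof.
move=> F FF _.
have [M [uM clM]] := @compact_unitarymx n (\val @ F) _
  (filterS (fun Q _ => unitary_groupP Q) filterT).
exists (SigSub (mem_set (uM : unitary_group R n M))); split=> // A B FA.
rewrite nbhsE => -[_ [[W oW <-] /= WM] WB].
have FvalA : (\val @ F) (\val @` A).
  by apply: (@filterS _ F _ A _ _ FA) => Q AQ; exists Q.
have [_ [[Q AQ <-] WQ]] := clM _ W FvalA (open_nbhs_nbhs (conj oW WM)).
by exists Q; split=> //; apply: WB.
Qed.

End CompactUnitary.

(** * Local minimizers over normal and over unitary matrices *)

Lemma local_minimizer_onT (R : realType) (T : topologicalType) (f : T -> R) x :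
  local_minimizer_on [set: T] f x <-> \forall y \near x, f x <= f y.
Proof.
by rewrite /local_minimizer_on withinET; split=> [[]//|]; split.
Qed.

Section LocalMinimizers.
Variables (R : realType) (n : nat) (A : 'M[R[i]]_n).
Local Notation C := R[i].
Local Notation dist2 := (fun X : 'M[C]_n => frobenius_sq (A - X)).
Implicit Types (Q : unitary_group R n) (N X : 'M[C]_n).

Lemma continuous_val_unitary : continuous (\val : unitary_group R n -> 'M[C]_n).
Proof. exact: initial_continuous. Qed.

Lemma continuous_diag_part (T : topologicalType) (f : T -> 'M[C]_n) :
  continuous f -> continuous (fun x => diag_part (f x)).
Proof.
move=> cf; apply: continuous_matrix => i j; under eq_fun do rewrite !mxE.
case: (i == j).
  by under eq_fun do rewrite mulr1n; exact: continuous_coord.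
by under eq_fun do rewrite mulr0n; move=> x; exact: cvg_cst.
Qed.

Lemma continuous_normal_of :
  continuous (normal_of A : unitary_group R n -> 'M[C]_n).
Proof.
have cv := continuous_val_unitary.
have cvt := continuous_trmxC cv.
have cA := @continuous_cst_mx R (unitary_group R n) _ _ A.
have cD := continuous_diag_part (continuous_mulmx (continuous_mulmx cvt cA) cv).
exact: continuous_mulmx (continuous_mulmx cv cD) cvt.
Qed.

Lemma near_normal_of Q (P : set 'M[C]_n) : nbhs (normal_of A Q) P ->
  \forall Q' \near Q, P (normal_of A Q').
Proof. exact: continuous_normal_of. Qed.

Lemma continuous_segment (N0 N : 'M[C]_n) :
  continuous (fun t : R => N0 + t%:C *: (N - N0)).
Proof.
apply: continuous_matrix => i j; under eq_fun do rewrite !mxE.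
move=> t; apply: (@cvgD C C); first exact: cvg_cst.
apply: (@cvgM C); last exact: cvg_cst.
exact: continuous_real_complex.
Qed.

(** The matrices diagonalized by [Q] form a linear subspace. *)
Lemma diagonalizers_segment (N0 N : 'M[C]_n) Q (t : R) :
  diagonalizers N0 Q -> diagonalizers N Q ->
  diagonalizers (N0 + t%:C *: (N - N0)) Q.
Proof.
move=> /is_diag_mxP dN0 /is_diag_mxP dN; apply/is_diag_mxP => i j ij.
rewrite mulmxDr mulmxDl -scalemxAr -scalemxAl mulmxBr mulmxBl.
rewrite [LHS]mxE dN0// add0r [LHS]mxE [X in _ * X]mxE dN// add0r.
by rewrite [X in _ * X]mxE dN0// oppr0 mulr0.
Qed.

(** [normal_of A Q] is the foot of the perpendicular from [A] to the space of
    matrices diagonalized by [Q]; the distance to that foot shrinks by the factor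
    [1 - t] along the segment. *)
Lemma frobenius_sq_dist_segment (N0 : 'M[C]_n) Q (t : R) :
  diagonalizers N0 Q ->
  frobenius_sq (A - (N0 + t%:C *: (normal_of A Q - N0)))
  = offdiag_cost A Q + (1 - t) ^+ 2 * frobenius_sq (normal_of A Q - N0).
Proof.
move=> dN0; have dN := @diagonalizers_normal_of R n A Q.
rewrite (frobenius_sq_dist A (diagonalizers_segment t dN0 dN)) -frobenius_sqZ.
congr (_ + frobenius_sq _).
by rewrite rmorphB scalerBl scale1r opprD addrA.
Qed.

Lemma near_segment (N0 N : 'M[C]_n) (P : set 'M[C]_n) : nbhs N0 P ->
  \forall t \near (0 : R)^'+, P (N0 + t%:C *: (N - N0)).
Proof.
move=> PN0; rewrite near_withinE.
have P0 : nbhs (N0 + (0 : R)%:C *: (N - N0)) P by rewrite scale0r addr0.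
have : \forall t \near (0 : R), P (N0 + t%:C *: (N - N0)).
  exact: (@continuous_segment N0 N 0 P P0).
by apply: filterS => t.
Qed.

(** Otherwise moving from [N0] slightly towards [normal_of A Q] would multiply
    the second term of [frobenius_sq_dist] by [(1 - t) ^+ 2 < 1], without
    leaving the normal matrices. *)
Lemma local_minimizer_normal_of (N0 : 'M[C]_n) Q :
  local_minimizer_on normal_set dist2 N0 -> diagonalizers N0 Q ->
  normal_of A Q = N0.
Proof.
move=> [_ minN] dN0; near (0 : R)^'+ => t.
have t0 : 0 < t by [].
have t1 : t < 1 by near: t; exact: nbhs_right_lt.
have /(_ (diagonalizers_normal (diagonalizers_segment t dN0 _))) :
    normal_set (N0 + t%:C *: (normal_of A Q - N0)) ->
    dist2 N0 <= dist2 (N0 + t%:C *: (normal_of A Q - N0)).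
  by near: t; exact: (near_segment (normal_of A Q) minN).
move=> /(_ (@diagonalizers_normal_of R n A Q)).
rewrite frobenius_sq_dist_segment// (frobenius_sq_dist A dN0) lerD2l => le_t.
apply/eqP; rewrite -subr_eq0; apply/eqP/frobenius_sq_eq0.
have := frobenius_sq_ge0 (normal_of A Q - N0).
rewrite le_eqVlt => /predU1P[<-//|F0].
move: le_t; rewrite -[leLHS]mul1r (ler_pM2r F0) leNgt exprn_ilt1//.
  by rewrite subr_ge0 ltW.
by rewrite ltrBlDr ltrDl.
Unshelve. all: by end_near. Qed.

(** [offdiag_cost A] is the squared distance to [A] composed with the continuous
    map [normal_of A] into the normal matrices. *)
Lemma local_minimizer_offdiag_cost (N0 : 'M[C]_n) Q :
  local_minimizer_on normal_set dist2 N0 -> normal_of A Q = N0 ->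
  local_minimizer_on [set: unitary_group R n] (offdiag_cost A) Q.
Proof.
move=> [_ minN] NQ; apply/local_minimizer_onT.
have minNQ :
    nbhs (normal_of A Q) [set X | normal_set X -> dist2 N0 <= dist2 X].
  by rewrite NQ; exact: minN.
apply: filterS (near_normal_of minNQ) => Q' minQ'.
rewrite !offdiag_costE NQ; apply: minQ'; exact: normal_of_normal.
Qed.

(** A nonzero off-diagonal entry of [Q^t* *m N0 *m Q] remains nonzero under a
    small joint perturbation of [Q] and [N0]. *)
Lemma open_nondiagonalizer (N0 : 'M[C]_n) Q : ~ diagonalizers N0 Q ->
  \forall Q' \near Q & X \near N0, ~ diagonalizers X Q'.
Proof.
move=> /negP ndN.
have [i [j [ij nz]]] :
    exists i j, i != j /\ ((\val Q)^t* *m N0 *m \val Q) i j != 0.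
  apply: contrapT => H; move/negP: ndN; apply; apply/is_diag_mxP => i j ij.
  apply: contrapT => /eqP nz; apply: H; exists i, j; split=> //.
pose g (p : unitary_group R n * 'M[C]_n) := (\val p.1)^t* *m p.2 *m \val p.1.
have c1 : continuous (fun p : unitary_group R n * 'M[C]_n => \val p.1).
  move=> p.
  exact: (continuous_comp (@cvg_fst _ _ _ _ _) (@continuous_val_unitary _)).
have c2 : continuous (fun p : unitary_group R n * 'M[C]_n => p.2).
  by move=> p; exact: cvg_snd.
have cg := continuous_mulmx (continuous_mulmx (continuous_trmxC c1) c2) c1.
have nzg : \forall p \near (Q, N0), g p i j != 0.
  exact: (@cvgr_neq0 C C _ _ _ _ _ (@continuous_coord R _ _ _ _ i j cg (Q, N0)) nz).
apply: filterS nzg => -[Q' X] /= nzX /is_diag_mxP/(_ i j ij) z.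
by rewrite z eqxx in nzX.
Qed.

(** Compactness of the unitary group is used in the form of [near_covering]: a
    property of pairs that holds near every [(Q, N0)] holds, for [X] near [N0],
    for all unitary matrices simultaneously.  Any diagonalizer of such a normal
    [X] then bounds the distance from below by [offdiag_cost_le]. *)
Lemma local_minimizer_of_diagonalizers (N0 : 'M[C]_n) : N0 \is normalmx ->
  (forall Q, diagonalizers N0 Q -> normal_of A Q = N0 /\
     local_minimizer_on [set: unitary_group R n] (offdiag_cost A) Q) ->
  local_minimizer_on normal_set dist2 N0.
Proof.
move=> nN minQ; split; first exact: nN.
have /compact_near_coveringP cU := @compact_unitary_group R n.
pose P X Q := diagonalizers X Q -> dist2 N0 <= offdiag_cost A Q.
have locP Q : [set: unitary_group R n] Q ->
    \forall Q' \near Q & X \near N0, P X Q'.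
  move=> _; have [dN|ndN] := pselect (diagonalizers N0 Q); last first.
    apply: filterS (open_nondiagonalizer ndN) => -[Q' X] nd dX.
    by case: (nd dX).
  have [NQ /local_minimizer_onT minQ'] := minQ Q dN.
  exists ([set Q' | offdiag_cost A Q <= offdiag_cost A Q'], setT).
    by split; [exact: minQ'|exact: filterT].
  by move=> [Q' X] [/= leQ _] _; rewrite -NQ -offdiag_costE.
apply: filterS (cU _ (nbhs N0) P _ locP) => X minX /normalmx_diagonalizer[Q dX].
exact: le_trans (minX Q I dX) (offdiag_cost_le A dX).
Qed.

Lemma local_minimizer_unitary (N0 : 'M[C]_n) : N0 \is normalmx ->
  local_minimizer_on normal_set dist2 N0 <->
  forall Q, diagonalizers N0 Q -> normal_of A Q = N0 /\
     local_minimizer_on [set: unitary_group R n] (offdiag_cost A) Q.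
Proof.
move=> nN; split=> [minN Q dN|]; last exact: local_minimizer_of_diagonalizers.
have NQ := local_minimizer_normal_of minN dN.
by split; [|exact: local_minimizer_offdiag_cost minN NQ].
Qed.

(** * Passage to the flag manifold *)

Lemma offdiag_cost_flag_rel (Q1 Q2 : unitary_group R n) :
  flag_rel Q1 Q2 -> offdiag_cost A Q1 = offdiag_cost A Q2.
Proof. by move=> /flag_classP E; rewrite -!flag_costE E. Qed.

Lemma unitary_rmul (D : 'M[C]_n) : D \is unitarymx ->
  exists r : unitary_group R n -> unitary_group R n,
    forall Q, \val (r Q) = \val Q *m D.
Proof.
move=> uD; have uQD Q : unitary_group R n (\val Q *m D).
  by apply: mul_unitarymx; [exact: unitary_groupP|exact: uD].
by exists (fun Q => SigSub (mem_set (uQD Q))).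
Qed.

Lemma near_unitary_rmul (D : 'M[C]_n)
    (r : unitary_group R n -> unitary_group R n)
    (P : set (unitary_group R n)) Q :
  (forall Q', \val (r Q') = \val Q' *m D) -> nbhs (r Q) P ->
  \forall Q' \near Q, P (r Q').
Proof.
move=> rE; have cr : continuous r.
  apply: continuous_comp_initial.
  rewrite (_ : _ \o _ = (fun Q' => \val Q' *m D)); last first.
    by apply/funext => Q'; exact: rE.
  exact: continuous_mulmx continuous_val_unitary (@continuous_cst_mx R _ _ _ D).
exact: cr.
Qed.

(** The nontrivial direction produces an open set of classes on which the cost
    is at least its value at [Q].  The set [S] of unitary matrices where this holds
    is saturated, and so is its interior because right translations are
    homeomorphisms; the image of that interior in the quotient is open. *)
Lemma local_minimizer_flag Q :
  local_minimizer_on [set: flag_manifold R n] (flag_cost A) (flag_class Q) <->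
  local_minimizer_on [set: unitary_group R n] (offdiag_cost A) Q.
Proof.
split=> /local_minimizer_onT minQ; apply/local_minimizer_onT.
  have : \forall Q' \near Q,
      flag_cost A (flag_class Q) <= flag_cost A (flag_class Q').
    exact: (@pi_continuous _ {eq_quot flag_equiv R n}%qT Q _ minQ).
  by apply: filterS => Q'; rewrite !flag_costE.
set S := [set Q' | offdiag_cost A Q <= offdiag_cost A Q'].
have QS : S° Q by exact: minQ.
have satS Q1 Q2 : flag_rel Q1 Q2 -> S° Q1 -> S° Q2.
  move=> /asboolP[D [uD dD E]].
  have uD' : D^t* \is unitarymx by rewrite trmxC_unitary.
  have [r rE] := unitary_rmul uD'.
  have rQ2 : r Q2 = Q1.
    by apply: val_inj; rewrite rE E -mulmxA (elimT unitarymxP uD) mulmx1.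
  rewrite -rQ2 => /(near_unitary_rmul rE).
  apply: filterS => Q'; rewrite /S/= (@offdiag_cost_flag_rel (r Q') Q')//.
  apply/asboolP; exists D; split; [exact: uD|exact: dD|].
  by rewrite rE -mulmxA (mulmx1C (elimT unitarymxP uD)) mulmx1.
have oV : open [set x : flag_manifold R n | S° (repr x)].
  rewrite /open/= /quotient_open (_ : _ @^-1` _ = S°); first exact: open_interior.
  have reprQ Q' : flag_rel (repr (flag_class Q')) Q'.
    by apply/flag_classP; rewrite /flag_class reprK.
  apply/seteqP; split=> Q' /=; first by apply: satS; exact: reprQ.
  apply: satS; apply/flag_classP; apply/esym/flag_classP; exact: reprQ.
apply: filterS (open_nbhs_nbhs (conj oV _)).
- by move=> x /interior_subset Sx; rewrite flag_costE.
- rewrite /=; apply: satS QS; apply/flag_classP.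
  by rewrite /flag_class reprK.
Qed.

End LocalMinimizers.

Local Close Scope complex_scope.
Local Close Scope sesquilinear_scope.
Unset Implicit Arguments.

Theorem theorem2p2 (R : realType) (n : nat) (A : 'M[R[i]]_n) :
  let dist2 := fun X : 'M[R[i]]_n => frobenius_sq (A - X) in
  [/\ (forall Q0 : unitary_group R n,
         global_minimizer_on [set: flag_manifold R n] (flag_cost A)
           (flag_class Q0)
         <-> global_minimizer_on normal_set dist2 (normal_of A Q0)),
      (forall N0 : 'M[R[i]]_n, N0 \is normalmx ->
         (local_minimizer_on normal_set dist2 N0
          <-> forall Q : unitary_group R n,
                diagonalizers N0 Q ->
                normal_of A Q = N0 /\
                local_minimizer_on [set: flag_manifold R n] (flag_cost A)
                  (flag_class Q))),
      (forall Q0 : unitary_group R n,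
         global_minimizer_on [set: unitary_group R n] (offdiag_cost A) Q0
         <-> global_minimizer_on normal_set dist2 (normal_of A Q0))
    & (forall N0 : 'M[R[i]]_n, N0 \is normalmx ->
         (local_minimizer_on normal_set dist2 N0
          <-> forall Q : unitary_group R n,
                diagonalizers N0 Q ->
                normal_of A Q = N0 /\
                local_minimizer_on [set: unitary_group R n] (offdiag_cost A)
                  Q))].
Proof.
move=> dist2; split.
- move=> Q0; rewrite global_minimizer_flag; exact: global_minimizer_unitary.
- move=> N0 nN; rewrite (local_minimizer_unitary A nN).
  split=> minQ Q /minQ[NQ mQ]; split; [exact: NQ| |exact: NQ|];
    exact/local_minimizer_flag.
- by move=> Q0; exact: global_minimizer_unitary.
- by move=> N0 nN; exact: local_minimizer_unitary.
Qed.
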